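(* Let $I\subset\mathbb{R}$ be an open interval, $A\subset\mathbb{R}$ a non-empty Borel set, $\mu$ a $\sigma$-finite Borel measure on $A$, and $u,v:A\to[0,+\infty)$ measurable functions, not simultaneously $0$ (i.e. there is no $t\in A$ with $u(t)=v(t)=0$). Let $f:I\times A\to(0,+\infty)$ be such that: (i) $a\mapsto f(a,t)$ is differentiable for $\mu$-a.e. $t\in A$; (ii) $t\mapsto u(t)f(a,t)$ and $t\mapsto v(t)f(a,t)$ are $\mu$-integrable for all $a\in I$; (iii) for each compact subset $K\subset I$ there exists a function $g_K:A\to[0,+\infty)$ such that $u g_K$ and $v g_K$ are $\mu$-integrable and $|\partial_a f(a,t)|\le g_K(t)$ for all $a\in K$ and $\mu$-a.e. $t\in A$. Assume that $\int_A f(a,t)v(t)\,d\mu(t)\neq 0$ for $a\in I$, and let $F:I\to\mathbb{R}$ be defined by $$F(a):=\frac{\int_A f(a,t)u(t)\,d\mu(t)}{\int_A f(a,t)v(t)\,d\mu(t)} .$$ Then the following hold. I. If for all $a\in I$ and for $\mu$-a.e. $t\in A$, $\partial_a f(a,t)/f(a,t)$ and $u(t)/v(t)$ both increase or both decrease with respect to $t$, then $F$ is increasing. II. If for all $a\in I$ and for $\mu$-a.e. $t\in A$, $\partial_a f(a,t)/f(a,t)$ increases (respectively decreases) with respect to $t$ and $u(t)/v(t)$ decreases (respectively increases) with respect to $t$, then $F$ is decreasing.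
   Context: $\partial_a$ denotes differentiation with respect to $a$. The quotient $u(t)/v(t)$ takes values in $[0,+\infty]$, with value $+\infty$ where $v(t)=0$. ''Increasing'' and ''decreasing'' are understood in the non-strict sense. A function increasing (decreasing) with respect to $t$ for $\mu$-a.e. $t\in A$ means that it is increasing (decreasing) on the complement in $A$ of a $\mu$-null set. *)

(* Defs.v *)
From mathcomp Require Import all_boot all_order all_algebra.
From mathcomp Require Import all_classical all_reals all_analysis.

Set Implicit Arguments.
Unset Strict Implicit.
Unset Printing Implicit Defensive.

Import Order.TTheory GRing.Theory Num.Theory.
Import numFieldNormedType.Exports.

Local Open Scope classical_set_scope.
Local Open Scope ring_scope.

Definition nondecreasing_on {R : realType} {d : Order.disp_t}
    {T : porderType d} (B : set R) (h : R -> T) : Prop :=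
  {in B &, {homo h : x y / x <= y >-> (x <= y)%O}}.

Definition nonincreasing_on {R : realType} {d : Order.disp_t}
    {T : porderType d} (B : set R) (h : R -> T) : Prop :=
  {in B &, {homo h : x y / x <= y >-> (y <= x)%O}}.

Definition ae_nondecreasing_on {R : realType} {d : Order.disp_t}
    {T : porderType d} (mu : {measure set (measurableTypeR R) -> \bar R})
    (A : set R) (h : R -> T) : Prop :=
  exists2 N : set R, mu.-negligible N & nondecreasing_on (A `\` N) h.

Definition ae_nonincreasing_on {R : realType} {d : Order.disp_t}
    {T : porderType d} (mu : {measure set (measurableTypeR R) -> \bar R})
    (A : set R) (h : R -> T) : Prop :=
  exists2 N : set R, mu.-negligible N & nonincreasing_on (A `\` N) h.

Definition equotient {R : realType} (u v : R -> R) (t : R) : \bar R :=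
  if v t == 0 then +oo%E else (u t / v t)%:E.

(* The junk value of the derivative at points where [f ^~ t] is not
   differentiable is harmless when this happens only for negligibly many t. *)
Definition dlog1 {R : realType} (f : R -> R -> R) (a t : R) : R :=
  partial1of2 f a t / f a t.

(* A measure on the Borel subsets of A is represented by a Borel measure [mu]
   on the line (e.g. its extension by zero); what [mu] does outside A is never
   used.  Likewise functions on A (resp. I x A) are total functions constrained
   only on A (resp. I x A). *)
Definition Fquot {R : realType}
    (mu : {measure set (measurableTypeR R) -> \bar R}) (A : set R)
    (f : R -> R -> R) (u v : R -> R) (a : R) : R :=
  (\int[mu]_(t in A) (f a t * u t)) / (\int[mu]_(t in A) (f a t * v t)).

(* Main.v *)
Require Import Defs.
From HB Require Import structures.
From mathcomp Require Import all_boot all_order all_algebra.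
From mathcomp Require Import all_classical all_reals all_analysis.
From mathcomp Require Import measurable_realfun ring lra.

(** Why the theorem holds.  Write w(s, t) = u(s) v(t) - u(t) v(s), let a <= b
    be points of I and put p = f(a, .), q = f(b, .).  Then F(a) <= F(b) says
    that (int q u)(int p v) - (int p u)(int q v) >= 0, and twice the left-hand
    side is the double integral over A x A of
      w(s, t) * (q(s) p(t) - q(t) p(s)).
    So it is enough that this integrand is nonnegative for almost every s and
    almost every t ([Rintegral_cross_le]).  Up to a positive factor, it is the
    increment from a to b of
      x |-> w(s, t) * f(x, s) / f(x, t),
    whose derivative is a positive multiple of
      w(s, t) * (L(x, s) - L(x, t)),   L = (d_x f) / f.
    The sign of w(s, t) is the sign of u(s)/v(s) - u(t)/v(t).  Hence, when L
    and u/v are monotone in the same sense, the derivative is nonnegative.  The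
    formulation with w makes the direction of monotonicity irrelevant, so it
    may depend on x; and the case of opposite monotonicity is the same
    statement with u and v exchanged.

    The difficulty lies in the null sets.  Monotonicity of L(x, .) holds off a
    null set that depends on x, and there are uncountably many x.  By Fubini,
    for almost every pair (s, t) the derivative above is nonnegative for
    Lebesgue-almost every x only ([ae_null_ysection]; the measurability that
    this requires is [measurable_fun_caratheodory] and
    [cvg_difference_quotient]).  This is still enough, by the theorem of
    Goldowsky and Tonelli: a function that is differentiable everywhere, with
    derivative nonnegative almost everywhere, is nondecreasing
    ([le_of_derive_ae_ge0]).  The two are combined in
    [ae_le_of_ae_derive_ge0], which [ratio_cross_le_ae] applies to the function
    of x displayed above. *)

Set Implicit Arguments.
Unset Strict Implicit.
Unset Printing Implicit Defensive.

Import Order.TTheory GRing.Theory Num.Theory.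
Import numFieldNormedType.Exports.

Local Open Scope classical_set_scope.
Local Open Scope ring_scope.

(** * Functions with almost everywhere nonnegative derivative *)

(** Let c be the supremum of the points x with k(a) <= k(x).  The left half of
    the local condition at c gives k(a) <= k(c); if c < b, its right half would
    give such points beyond c. *)
Lemma local_nondecreasing_le (R : realType) (k : R -> R) (a b : R) : a <= b ->
  (forall x, a <= x <= b -> \forall y \near x, a <= y <= b ->
     (x <= y -> k x <= k y) /\ (y <= x -> k y <= k x)) ->
  k a <= k b.
Proof.
move=> ab kloc; pose S := [set x | a <= x <= b /\ k a <= k x].
have Sa : S a by rewrite /S/= lexx ab.
have ubS : ubound S b by move=> x [/andP[]].
have supS : has_sup S by split; [exists a | exists b].
set c := sup S.
have ac : a <= c by apply: ub_le_sup => //; exists b.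
have cb : c <= b by apply: ge_sup => //; exists a.
have acb : a <= c <= b by rewrite ac.
have [e /= e0 He] := kloc c acb.
have kac : k a <= k c.
  have [x Sx cx] := sup_adherent e0 supS.
  have xc : x <= c by apply: ub_le_sup => //; exists b.
  case: Sx => axb kax; apply: (le_trans kax).
  by apply: (He x _ axb).2 => //=; rewrite ger0_norm ?subr_ge0//
    ltrBlDr -ltrBlDl.
have [<-//|cltb] := eqVneq c b.
have {cltb}cltb : c < b by rewrite lt_neqAle cltb.
pose y := Num.min b (c + e / 2).
have cy : c < y by rewrite lt_min cltb ltrDl divr_gt0.
have yb : y <= b by rewrite ge_min lexx.
have ayb : a <= y <= b by rewrite yb (le_trans ac) ?ltW.
have : y <= c.
  apply: ub_le_sup; first by exists b.
  split=> //; apply: (le_trans kac); apply: (He y _ ayb).1; last exact: ltW.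
  rewrite /= distrC ger0_norm ?subr_ge0 ?ltW// ltrBlDl.
  by rewrite gt_min; apply/orP; right; rewrite ltrD2l; lra.
by rewrite leNgt cy.
Qed.

(** The correction term of the Goldowsky-Tonelli argument.  Take open
    sets U_i, each containing E, with Lebesgue measures adding up to at most
    eps, and let g(x) be the sum over i of the measure of the part of U_i to the
    left of x.  Near a point of E, each of U_0, ..., U_(n-1) contributes slope
    one to g, so all difference quotients of g are at least n there. *)
Lemma steep_on_null_set (R : realType) (E : set R) (eps : R) :
  measurable E -> lebesgue_measure E = 0%E -> 0 < eps ->
  exists g : R -> R,
    [/\ forall x, 0 <= g x <= eps,
        {homo g : x y / x <= y}
      & forall x n, E x -> \forall y \near x, n%:R * `|y - x| <= `|g y - g x|].
Proof.
move=> mE E0 eps0.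
pose mu : measure _ R := @lebesgue_measure R.
have e_gt0 n : 0 < eps / (2 ^ n.+1)%:R by rewrite divr_gt0// ltr0n expn_gt0.
have /choice[U HU] : forall n, exists U : set R,
    [/\ open U, E `<=` U & (mu U <= (eps / (2 ^ n.+1)%:R)%:E)%E].
  move=> n; have [|U [oU EU UE]] := lebesgue_regularity_outer mE _ (e_gt0 n).
    by rewrite [X in (X < _)%E]E0 ltry.
  have mU : measurable U by exact: open_measurable.
  exists U; split => //; have -> : mu U = (mu E + mu (U `\` E))%E.
    rewrite -[in LHS](setDUK EU); apply: measureU => //.
      exact: measurableD.
    by rewrite setDE setICA setICr setI0.
  by rewrite [X in (X + _)%E]E0 add0e ltW.
have oU n : open (U n) by case: (HU n).
have mU n : measurable (U n) by exact: open_measurable.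
have EU n : E `<=` U n by case: (HU n).
pose G x := (\sum_(0 <= i <oo) mu (U i `&` `]-oo, x]%classic))%E.
have G0 x : (0 <= G x)%E by apply: nneseries_ge0.
have Geps x : (G x <= eps%:E)%E.
  apply: le_trans (epsilon_trick0 xpredT (ltW eps0)).
  apply: lee_nneseries => // n _; have [_ _] := HU n; apply: le_trans.
  apply: le_measure; last exact: subIsetl; rewrite inE; last exact: mU.
  by apply: measurableI; [exact: mU|exact: measurable_itv].
(* the increment of g over an interval, which is what the U_i contribute *)
have GE x y : x <= y ->
    G y = (G x + \sum_(0 <= i <oo) mu (U i `&` `]x, y]%classic))%E.
  move=> xy; rewrite /G -nneseriesD//; apply: eq_eseriesr => i _.
  rewrite -measureU; first last.
  - apply/seteqP; split => // z [[_ zx] [_ xz]].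
    move: zx xz; rewrite /= !in_itv/= => zx /andP[xz _].
    by have := le_lt_trans zx xz; rewrite ltxx.
  - by apply: measurableI; [exact: mU|exact: measurable_itv].
  - by apply: measurableI; [exact: mU|exact: measurable_itv].
  rewrite -setIUr; congr (mu (_ `&` _)); apply/seteqP; split => z /=.
    by rewrite !in_itv/= => ->; rewrite andbT; case: leP; [left|right].
  by rewrite !in_itv/= => -[zx|/andP[]//]; exact: le_trans xy.
have Gfin x : G x \is a fin_num.
  by rewrite ge0_fin_numE// (le_lt_trans (Geps x)) ?ltry.
pose g x := fine (G x).
have gE x : (g x)%:E = G x by rewrite /g fineK.
have ghomo : {homo g : x y / x <= y}.
  move=> x y xy; rewrite -lee_fin !gE (GE _ _ xy) leeDl//.
  exact: nneseries_ge0.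
have gsteep x y n : x <= y -> (forall i : 'I_n, `]x, y]%classic `<=` U i) ->
    n%:R * (y - x) <= g y - g x.
  move=> xy xyU; rewrite lerBrDl -lee_fin EFinD !gE (GE _ _ xy) leeD2l//.
  apply: le_trans (nneseries_lim_ge n _) => //.
  rewrite (eq_big_nat _ _ (F2 := fun=> (y - x)%:E)).
    by rewrite sumEFin lee_fin big_const_nat subn0 iter_addr_0 mulr_natl.
  move=> i /andP[_ ilt]; rewrite setIidr; last exact: (xyU (Ordinal ilt)).
  apply: (etrans (lebesgue_measure_itv _)); rewrite /= lte_fin; case: ltP => //.
  by move=> yx; congr EFin; apply/esym/eqP; rewrite subr_eq0 eq_le xy yx.
exists g; split=> // [x|x n Ex].
  by rewrite -!lee_fin gE G0 Geps.
have near_U (i : 'I_n) : \forall y \near x, exists2 e,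
    `|x - y| < e & ball x e `<=` U i.
  have /nbhs_ballP[e /= e0 xeU] : nbhs x (U i).
    by apply: open_nbhs_nbhs; split => //; exact: EU.
  by exists e => //= y xy; exists e.
have {}near_U := filter_forall _ near_U.
near=> y.
have yU : forall i : 'I_n, exists2 e, `|x - y| < e & ball x e `<=` U i.
  by near: y; exact: near_U.
have [xy|/ltW yx] := leP x y.
  rewrite !ger0_norm ?subr_ge0 ?ghomo//; apply: gsteep => // i z /=.
  rewrite in_itv/= => /andP[xz zy]; have [e xye] := yU i; apply.
  rewrite /ball/= distrC gtr0_norm ?subr_gt0//; apply: le_lt_trans xye.
  by rewrite distrC ger0_norm ?subr_ge0// lerD2r.
rewrite !ler0_norm ?subr_le0 ?ghomo// !opprB; apply: gsteep => // i z /=.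
rewrite in_itv/= => /andP[yz zx]; have [e xye] := yU i; apply.
rewrite /ball/= ger0_norm ?subr_ge0//; apply: le_lt_trans xye.
by rewrite ger0_norm ?subr_ge0// lerD2l lerN2 ltW.
Unshelve. all: by end_near. Qed.

(** First order expansion with an explicit constant: the form in which
    differentiability feeds the local comparison below. *)
Lemma is_derive_near (R : realType) (h : R -> R) (x c e : R) :
  is_derive x (1 : R) h c -> 0 < e ->
  \forall y \near x, `|h y - h x - c * (y - x)| <= e * `|y - x|.
Proof.
move=> hx e0.
have : (fun t => t^-1 *: (h (t *: (1 : R) + x) - h x)) @ 0^' --> c.
  have -> : c = 'D_1 h x by rewrite derive_val.
  exact: ex_derive.
move=> /cvgrPdist_le /(_ _ e0).
rewrite near_withinE => -[d /= d0 hd].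
exists d => //= y; rewrite /ball/= => xyd.
have [->|yx] := eqVneq y x; first by rewrite !subrr mulr0 subr0 normr0 mulr0.
have yx0 : y - x != 0 by rewrite subr_eq0.
have := hd (y - x); rewrite /ball/= sub0r normrN (distrC y) => /(_ xyd yx0).
have -> : (y - x) *: (1 : R) + x = y by rewrite scaler1 subrK.
rewrite /GRing.scale/= => H.
have -> : h y - h x - c * (y - x) =
    - ((c - (y - x)^-1 * (h y - h x)) * (y - x)).
  by field.
by rewrite normrN normrM (distrC x) ler_wpM2r.
Qed.

(** Goldowsky-Tonelli theorem.  Let E be a null set containing the points where
    the derivative of h is negative.  Adding to h the small linear function
    e * x and a function g of total variation at most e that is steep on E
    makes it locally nondecreasing everywhere: on E the slope of g beats the
    finite derivative of h.  Then let e tend to 0. *)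
Lemma le_of_derive_ae_ge0 (R : realType) (h : R -> R) (a b : R) : a <= b ->
  (forall x, a <= x <= b -> derivable h x 1) ->
  (@lebesgue_measure R).-negligible [set x | a <= x <= b /\ 'D_1 h x < 0] ->
  h a <= h b.
Proof.
move=> ab dh [E [mE E0 hE]].
suff key e : 0 < e -> h a <= h b + e * (b - a) + e.
  apply/ler_addgt0Pr => e e0.
  have ba0 : 0 < b - a + 1 by rewrite ltr_wpDl// subr_ge0.
  have := key (e / (b - a + 1)) (divr_gt0 e0 ba0).
  by rewrite -addrA -{2}[e / _]mulr1 -mulrDr divfK// gt_eqF.
move=> e0; have [g [g01 gh gE]] := steep_on_null_set mE E0 e0.
pose k x := h x + e * x + g x.
suff : k a <= k b.
  rewrite /k; have /andP[ga _] := g01 a; have /andP[_ gb] := g01 b.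
  by move=> H; rewrite mulrBr; lra.
apply: local_nondecreasing_le => // x axb.
pose c : R := 'D_1 h x.
have hc : is_derive x (1 : R) h c by split => //; exact: dh.
(* n is the slope that has to be borrowed from g at x *)
have [n [hn gn]] : exists n : nat, 0 <= c + n%:R /\
    \forall y \near x, n%:R * `|y - x| <= `|g y - g x|.
  have [hx0|hx0] := ltP c 0.
    exists (Num.bound `|c|); split; last by apply: gE; apply: hE.
    rewrite -lerBlDl sub0r ltW// (le_lt_trans (ler_norm _))//.
    by rewrite normrN archi_boundP.
  by exists 0; split; [rewrite addr0|near=> y; rewrite mul0r].
near=> y => _.
have hy : `|h y - h x - c * (y - x)| <= e * `|y - x|.
  by near: y; exact: is_derive_near.
have gy : n%:R * `|y - x| <= `|g y - g x| by near: y.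
move: hy; rewrite ler_norml => /andP[hy1 hy2]; split => xy.
  have d0 : 0 <= y - x by rewrite subr_ge0.
  move: hy1 gy; rewrite !ger0_norm ?subr_ge0 ?gh//.
  have := mulr_ge0 hn d0; rewrite /k; nra.
have d0 : 0 <= x - y by rewrite subr_ge0.
move: hy2 gy; rewrite (distrC y) (distrC (g y)) !ger0_norm ?subr_ge0 ?gh//.
have := mulr_ge0 hn d0; rewrite /k; nra.
Unshelve. all: by end_near. Qed.

(** * Joint measurability *)

(** Functions continuous in the first variable and measurable in the second one
    are jointly measurable, being pointwise limits of functions that are
    constant in x on the cells [k/(n+1), (k+1)/(n+1)[. *)
Lemma measurable_fun_caratheodory d (T : measurableType d) (R : realType)
    (D : set T) (F : R -> T -> R) :
  measurable D -> (forall x, measurable_fun D (F x)) ->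
  (forall t, D t -> continuous (F ^~ t)) ->
  measurable_fun ([set: measurableTypeR R] `*` D)
    (fun z : measurableTypeR R * T => F z.1 z.2).
Proof.
move=> mD mF cF.
pose step n (x : R) : R := (Num.floor (x * n.+1%:R))%:~R / n.+1%:R.
apply: (@measurable_fun_cvg _ _ _ _ (fun n z => F (step n z.1) z.2)); last first.
  move=> [x t] [_ /= Dt].
  suff step_cvg : step ^~ x @ \oo --> x.
    exact: cvg_comp step_cvg (cF t Dt x).
  apply/cvgrPdist_le => e e0.
  have := @cvg_harmonic R.
  move=> /cvgrPdist_le /(_ _ e0); apply: filterS => n.
  rewrite sub0r normrN /= ger0_norm ?invr_ge0//; apply: le_trans.
  have n0 : (0 : R) < n.+1%:R by rewrite ltr0n.
  have /andP[fl fu] := floor_itv (x * n.+1%:R).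
  rewrite ger0_norm /step.
    rewrite -(ler_pM2r n0) mulVf ?gt_eqF// mulrBl divfK ?gt_eqF//.
    by rewrite lerBlDl ltW// -[X in _ + X]/(1%:~R) -intrD.
  by rewrite subr_ge0 ler_pdivrMr.
move=> n _ /= Y mY.
have n0 : (0 : R) < n.+1%:R by rewrite ltr0n.
pose cell (k : int) : set (measurableTypeR R) :=
  `[k%:~R / n.+1%:R, (k + 1)%:~R / n.+1%:R[%classic.
have cellP (x : R) k : cell k x <-> Num.floor (x * n.+1%:R) = k.
  rewrite /cell/= in_itv/= ler_pdivrMr// ltr_pdivlMr// -floor_eq.
  by split => [/eqP|->].
rewrite [X in measurable X](_ : _ =
  \bigcup_(k : int) (cell k `*` (D `&` F (k%:~R / n.+1%:R) @^-1` Y))).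
  apply: countable_bigcupT_measurable => [|k]; first exact: countableP.
  by apply: measurableX; [exact: measurable_itv|exact: mF].
apply/seteqP; split=> [[x t] [[_ /= Dt] Yt]|[x t] [k _ [/= /cellP xk [Dt Yt]]]].
  by exists (Num.floor (x * n.+1%:R)) => //; split => //=; apply/cellP.
by split => //=; rewrite /step xk.
Qed.

(** A derivative is the limit of a sequence, hence inherits measurability. *)
Lemma cvg_difference_quotient (R : realType) (h : R -> R) (x : R) :
  derivable h x 1 ->
  n.+1%:R * (h (x + n.+1%:R^-1) - h x) @[n --> \oo] --> ('D_1 h x : R).
Proof.
move=> dh.
pose quot t := t^-1 *: (h (t *: (1 : R) + x) - h x).
have hq : quot @ 0^' --> 'D_1 h x by exact: dh.
apply: (@cvg_trans _ (quot (@harmonic R n) @[n --> \oo])).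
  apply: near_eq_cvg; near=> n.
  by rewrite /quot /harmonic/= invrK scaler1 [_ + x]addrC.
apply: cvg_comp hq => P P0.
have : \forall t \near 0^', P t by [].
rewrite near_withinE => /cvg_harmonic {}P0.
have : \forall n \near \oo, @harmonic R n != 0 -> P (harmonic n) by exact: P0.
by apply: filterS => n; apply; rewrite gt_eqF// harmonic_gt0.
Unshelve. all: by end_near. Qed.

(** * Null sections and restricted measures *)

(** By Tonelli, integrating the measures of the x-sections or those of the
    y-sections of W gives the same value, here 0.  This is what exchanges a
    null set of y depending on x for a null set of x depending on y. *)
Lemma ae_null_ysection d1 d2 (T1 : measurableType d1) (T2 : measurableType d2)
    (R : realType) (m1 : {sigma_finite_measure set T1 -> \bar R})
    (m2 : {sigma_finite_measure set T2 -> \bar R}) (W : set (T1 * T2)) :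
  measurable W -> (forall x, m2 (xsection W x) = 0%E) ->
  {ae m2, forall y, m1 (ysection W y) = 0%E}.
Proof.
move=> mW W0.
have := indic_fubini_tonelli m1 m2 mW.
rewrite indic_fubini_tonelli_FE// indic_fubini_tonelli_GE//.
rewrite integral0_eq; last by move=> x _ /=.
move=> /esym I0.
have mG : measurable_fun setT (m1 \o ysection W).
  by exact: measurable_fun_ysection.
have /(ae_eq_integral_abs m2 measurableT mG) :
    (\int[m2]_(y in setT) `|(m1 \o ysection W) y| = 0)%E.
  by rewrite -[RHS]I0; apply: eq_integral => y _; rewrite gee0_abs.
by apply: filterS => y; exact.
Qed.

Lemma ae_null_xsection d1 d2 (T1 : measurableType d1) (T2 : measurableType d2)
    (R : realType) (m1 : {measure set T1 -> \bar R})
    (m2 : {sigma_finite_measure set T2 -> \bar R}) (P : T1 * T2 -> Prop) :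
  {ae (m1 \x m2)%E, forall z, P z} ->
  {ae m1, forall x, {ae m2, forall y, P (x, y)}}.
Proof.
move=> [Z [mZ Z0 PZ]].
have mF : measurable_fun setT (m2 \o xsection Z).
  by exact: measurable_fun_xsection.
have /(ae_eq_integral_abs m1 measurableT mF) :
    (\int[m1]_(x in setT) `|(m2 \o xsection Z) x| = 0)%E.
  rewrite -[RHS]Z0; apply: eq_integral => x _; rewrite gee0_abs//.
apply: filterS => x /(_ I) /= Zx0.
exists (xsection Z x); split => //; first exact: measurable_xsection.
by move=> y /= nP; rewrite /xsection/= inE; apply: PZ.
Qed.

(** Turns sigma-finiteness of mu on a set into the structure of a
    sigma-finite measure on the whole type, as the product measure expects. *)
Lemma restrict_sigma_finite d (T : measurableType d) (R : realType)
    (mu : {measure set T -> \bar R}) (A : set T) :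
  measurable A -> sigma_finite A mu ->
  exists m : {sigma_finite_measure set T -> \bar R},
    forall X, m X = mu (X `&` A).
Proof.
move=> mA [F AF mF].
have sf : sigma_finite setT (mrestr mu mA).
  exists (fun n => F n `|` ~` A) => [|n].
    apply/seteqP; split=> // t _; have [At|nAt] := pselect (A t).
      by move: (At); rewrite {1}AF => -[n _ Fnt]; exists n => //; left.
    by exists 0 => //; right.
  have [mFn Fn_fin] := mF n.
  split; first by apply: measurableU => //; exact: measurableC.
  rewrite /mrestr setIUl setICl setU0; apply: le_lt_trans Fn_fin.
  by apply: le_measure; rewrite ?inE//; exact: measurableI.
pose H := @Measure_isSigmaFinite.Build _ _ _ (mrestr mu mA) sf.
pose m : {sigma_finite_measure set T -> \bar R} := HB.pack (mrestr mu mA) H.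
by exists m.
Qed.

Lemma ae_restrict d (T : measurableType d) (R : realType)
    (mu m : {measure set T -> \bar R}) (A : set T) (P : T -> Prop) :
  measurable A -> (forall X, m X = mu (X `&` A)) ->
  {ae m, forall t, P t} -> {ae mu, forall t, A t -> P t}.
Proof.
move=> mA mE [Z [mZ]]; rewrite mE => ZA PZ; exists (Z `&` A); split => //.
  exact: measurableI.
by move=> t /= /not_implyP[At nP]; split => //; exact: PZ.
Qed.

Lemma sigma_finite_product d1 d2 (T1 : measurableType d1)
    (T2 : measurableType d2) (R : realType)
    (m1 : {sigma_finite_measure set T1 -> \bar R})
    (m2 : {sigma_finite_measure set T2 -> \bar R}) (D : set (T1 * T2)) :
  measurable D -> sigma_finite D (m1 \x m2)%E.
Proof.
move=> mD.
have /sigma_finiteP[F [FT ndF finF]] := sigma_finiteT m1.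
have /sigma_finiteP[G [GT ndG finG]] := sigma_finiteT m2.
have mFG n : measurable (F n `*` G n).
  by apply: measurableX; [case: (finF n)|case: (finG n)].
exists (fun n => D `&` (F n `*` G n)) => [|n].
  apply/seteqP; split => [[x y] Dxy|z [n _ []]//].
  have [n _ Fnx] : (\bigcup_i F i) x by rewrite -FT.
  have [k _ Gky] : (\bigcup_i G i) y by rewrite -GT.
  exists (maxn n k) => //; split => //; split => /=.
    by move: Fnx; apply/subsetPset/ndF/leq_maxl.
  by move: Gky; apply/subsetPset/ndG/leq_maxr.
split; first exact: measurableI.
apply: (@le_lt_trans _ _ ((m1 \x m2)%E (F n `*` G n))).
  by apply: le_measure; rewrite ?inE//; exact: measurableI.
have [[mFn Fn] [mGn Gn]] := (finF n, finG n).
by rewrite product_measure1E// lte_mul_pinfty// ge0_fin_numE.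
Qed.

(** * Monotonicity in a parameter, almost everywhere *)

(** The null set where the derivative may be negative is allowed to depend on
    the parameter x.  The set W of the pairs (x, t) with a < x < b at which
    the derivative is negative is measurable and has null sections at every
    x.  So for almost every t, its section at t is Lebesgue-null, and the
    Goldowsky-Tonelli theorem applies to F(., t). *)
Lemma ae_le_of_ae_derive_ge0 d (T : measurableType d) (R : realType)
    (mu : {measure set T -> \bar R}) (D : set T) (F : R -> T -> R) (a b : R) :
  measurable D -> sigma_finite D mu -> a <= b ->
  (forall x, a <= x <= b -> measurable_fun D (F x)) ->
  (forall t, D t -> forall x, a <= x <= b -> derivable (F ^~ t) x 1) ->
  (forall x, a <= x <= b ->
     {ae mu, forall t, D t -> 0 <= ('D_1 (F ^~ t) x : R)}) ->
  {ae mu, forall t, D t -> F a t <= F b t}.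
Proof.
move=> mD sfD ab mF dF F0.
have [m mE] := restrict_sigma_finite mD sfD.
(* c retracts the line onto [a, b]: it makes the parameter range over all of R
   and does not change derivatives inside the interval *)
pose c (x : R) : R := Num.max a (Num.min x b).
have cab x : a <= c x <= b.
  by rewrite /c le_max lexx /= ge_max ab ge_min lexx orbT.
have cE x : a <= x <= b -> c x = x.
  by move=> /andP[ax xb]; rewrite /c min_l// max_r.
have cc : continuous c.
  move=> x; apply: (@continuous_max _ _ (cst a) (fun y => Num.min y b)).
    exact: cvg_cst.
  by apply: continuous_min; [exact: cvg_id|exact: cvg_cst].
have cF r t : D t -> continuous (fun x => F (c (x + r)) t).
  move=> Dt x.
  apply: (@cvg_comp _ _ _ (fun x => c (x + r)) (F ^~ t) _ (nbhs (c (x + r)))).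
    apply: (@cvg_comp _ _ _ (fun x => x + r) c _ (nbhs (x + r))); last exact: cc.
    by apply: cvgD; [exact: cvg_id|exact: cvg_cst].
  have : {for c (x + r), continuous (F ^~ t)}; last exact.
  by apply/differentiable_continuous/derivable1_diffP; exact: dF.
pose S := (`]a, b[%classic : set (measurableTypeR R)) `*` D.
have mS : measurable S by apply: measurableX => //; exact: measurable_itv.
have mFc r :
    measurable_fun S (fun z : measurableTypeR R * T => F (c (z.1 + r)) z.2).
  apply: measurable_funS (measurable_fun_caratheodory mD _ (cF r)).
  - exact: measurableX.
  - by apply: setSX => //; exact: subsetT.
  - by move=> x; exact: mF.
pose dFz (z : measurableTypeR R * T) : R := 'D_1 (F ^~ z.2) z.1.
have mdF : measurable_fun S dFz.
  apply: (@measurable_fun_cvg _ _ _ S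
    (fun n (z : measurableTypeR R * T) =>
      (n.+1%:R * (F (c (z.1 + n.+1%:R^-1)) z.2 - F (c (z.1 + 0)) z.2) : R))).
    by move=> n; apply: measurable_funM => //; apply: measurable_funB.
  move=> [x t] [/= xab Dt].
  move: xab; rewrite in_itv/= => /andP[ax xb].
  have axb : a <= x <= b by rewrite !ltW.
  apply: cvg_trans (cvg_difference_quotient (dF t Dt x axb)).
  apply: near_eq_cvg; rewrite addr0 cE//.
  have bx : 0 < b - x by rewrite subr_gt0.
  have := @cvg_harmonic R; move=> /cvgrPdist_le /(_ _ bx); apply: filterS => n.
  rewrite sub0r normrN /= ger0_norm ?invr_ge0// => nbx.
  by rewrite cE// -lerBrDl nbx andbT (le_trans (ltW ax))// lerDl.
pose W := S `&` dFz @^-1` `]-oo, 0[%classic.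
have mW : measurable W by apply: mdF => //; exact: measurable_itv.
have W0 x : m (xsection W x) = 0%E.
  have [axb|axb] := boolP (a <= x <= b).
    rewrite mE; apply: measure_negligible.
      by apply: measurableI => //; exact: measurable_xsection.
    apply: negligibleS (F0 x axb) => t.
    rewrite /xsection/= => -[/[!inE] -[_]] /= + Dt.
    rewrite in_itv/= /dFz/= ltNge => /negP nF.
    by apply: contra_not nF; exact.
  rewrite (_ : xsection _ _ = set0) ?measure0//; apply/seteqP; split=> // t.
  rewrite /xsection/= inE => -[[/= + _] _]; rewrite in_itv/= => /andP[ax xb].
  by move/negP: axb; rewrite !ltW.
have := @ae_null_ysection _ _ _ _ _ (@lebesgue_measure R) m W mW W0.
move=> /(ae_restrict mD mE); apply: filterS => t Wt0 Dt.
have {}Wt0 := Wt0 Dt; apply: (@le_of_derive_ae_ge0 _ (F ^~ t)) => //.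
  by move=> x; exact: dF.
apply: (@negligibleS _ _ _ _ (ysection W t `|` ([set a] `|` [set b]))).
  move=> x [/= /andP[]]; rewrite !le_eqVlt => /predU1P[->|ax].
    by right; left.
  move=> /predU1P[->|xb Fx]; first by right; right.
  left; rewrite /ysection/= inE; split; last by rewrite /= in_itv.
  by split => //=; rewrite in_itv/= ax.
apply: negligibleU.
  by apply/negligibleP => //; exact: measurable_ysection.
by apply: negligibleU; apply/negligibleP => //; exact: lebesgue_measure_set1.
Qed.

(** * The double integral inequality *)

Lemma ae_Rintegral_ge0 d (T : measurableType d) (R : realType)
    (mu : {measure set T -> \bar R}) (A : set T) (f : T -> R) :
  measurable A -> mu.-integrable A (EFin \o f) ->
  {ae mu, forall t, A t -> 0 <= f t} -> 0 <= \int[mu]_(t in A) f t.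
Proof.
move=> mA intf [N [mN N0 fN]]; rewrite /Rintegral (negligible_integral mN)//.
apply: Rintegral_ge0 => t [At Nt]; apply: contrapT => ft.
by apply/Nt/fN => /= /(_ At).
Qed.

Lemma Rintegral_linear4 d (T : measurableType d) (R : realType)
    (mu : {measure set T -> \bar R}) (A : set T) (f1 f2 f3 f4 : T -> R)
    (c1 c2 c3 c4 : R)
    (f := fun t => c1 * f1 t - c2 * f2 t - c3 * f3 t + c4 * f4 t) :
  measurable A ->
  mu.-integrable A (EFin \o f1) -> mu.-integrable A (EFin \o f2) ->
  mu.-integrable A (EFin \o f3) -> mu.-integrable A (EFin \o f4) ->
  mu.-integrable A (EFin \o f) /\
  \int[mu]_(t in A) f t =
  c1 * \int[mu]_(t in A) f1 t - c2 * \int[mu]_(t in A) f2 t -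
  c3 * \int[mu]_(t in A) f3 t + c4 * \int[mu]_(t in A) f4 t.
Proof.
move=> mA i1 i2 i3 i4.
have iZ c g : mu.-integrable A (EFin \o g) ->
    mu.-integrable A (EFin \o (fun t => c * g t)) by exact: integrableZl.
have iB g h : mu.-integrable A (EFin \o g) -> mu.-integrable A (EFin \o h) ->
    mu.-integrable A (EFin \o (fun t => g t - h t)) by exact: integrableB.
have iD g h : mu.-integrable A (EFin \o g) -> mu.-integrable A (EFin \o h) ->
    mu.-integrable A (EFin \o (fun t => g t + h t)) by exact: integrableD.
have J1 := iZ c1 _ i1; have J2 := iZ c2 _ i2.
have J3 := iZ c3 _ i3; have J4 := iZ c4 _ i4.
have J12 := iB _ _ J1 J2; have J123 := iB _ _ J12 J3.
split; first exact: iD.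
by rewrite RintegralD// RintegralB// RintegralB// !RintegralZl.
Qed.

(** Integrating the hypothesis in t, and then in s, gives twice the difference
    of the two sides of the conclusion.  Iterating one-dimensional integrals
    only uses their linearity, since each integrand is a sum of four products
    of a function of s and a function of t. *)
Lemma Rintegral_cross_le d (T : measurableType d) (R : realType)
    (mu : {measure set T -> \bar R}) (A : set T) (p q u v : T -> R) :
  measurable A ->
  mu.-integrable A (fun t => (p t * u t)%:E) ->
  mu.-integrable A (fun t => (p t * v t)%:E) ->
  mu.-integrable A (fun t => (q t * u t)%:E) ->
  mu.-integrable A (fun t => (q t * v t)%:E) ->
  {ae mu, forall s, A s -> {ae mu, forall t, A t ->
     0 <= (u s * v t - u t * v s) * (q s * p t - q t * p s)}} ->
  (\int[mu]_(t in A) (p t * u t)) * (\int[mu]_(t in A) (q t * v t)) <=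
  (\int[mu]_(t in A) (q t * u t)) * (\int[mu]_(t in A) (p t * v t)).
Proof.
move=> mA ipu ipv iqu iqv H.
set PU := \int[mu]_(t in A) (p t * u t).
set QV := \int[mu]_(t in A) (q t * v t).
set QU := \int[mu]_(t in A) (q t * u t).
set PV := \int[mu]_(t in A) (p t * v t).
have L c1 c2 c3 c4 := Rintegral_linear4 c1 c2 c3 c4 mA ipv iqv ipu iqu.
have inner s : {ae mu, forall t, A t ->
    0 <= (u s * v t - u t * v s) * (q s * p t - q t * p s)} ->
    0 <= u s * q s * PV - u s * p s * QV - v s * q s * PU + v s * p s * QU.
  move=> Hs; have [iL <-] := L (u s * q s) (u s * p s) (v s * q s) (v s * p s).
  apply: ae_Rintegral_ge0 => //.
  apply: filterS Hs => t /[apply]; congr (0 <= _); ring.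
have [iL EL] := Rintegral_linear4 PV QV PU QU mA iqu ipu iqv ipv.
have : 0 <= PV * QU - QV * PU - PU * QV + QU * PV.
  rewrite -EL; apply: ae_Rintegral_ge0 => //.
  apply: filterS H => s /[apply] /inner; congr (0 <= _); ring.
lra.
Qed.

(** * The ratio f(x, s) / f(x, t) *)

Lemma measurable_fun_inv_gt0 d (T : measurableType d) (R : realType)
    (D : set T) (g : T -> R) :
  (forall t, D t -> 0 < g t) -> measurable_fun D g ->
  measurable_fun D (fun t => (g t)^-1).
Proof.
move=> g0 mg.
apply: (eq_measurable_fun (fun t => expR (- ln (g t)))).
  by move=> t; rewrite inE => /g0 gt0; rewrite expRN lnK.
apply: measurableT_comp => //; apply: measurable_funN.
exact: measurableT_comp.
Qed.

(** With w(s, t) = u(s) v(t) - u(t) v(s), this follows from monotonicity in x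
    of F x (s, t) = w(s, t) * (f x s / f x t) for almost every pair (s, t):
    the x-derivative of F is the positive number f x s / f x t times
    w(s, t) * (dlog1 f x s - dlog1 f x t). *)
Lemma ratio_cross_le_ae (R : realType)
    (mu : {measure set (measurableTypeR R) -> \bar R})
    (A : set (measurableTypeR R)) (f : R -> measurableTypeR R -> R)
    (u v : measurableTypeR R -> R) (a b : R) :
  measurable A -> sigma_finite A mu -> a <= b ->
  measurable_fun A u -> measurable_fun A v ->
  (forall x, a <= x <= b -> measurable_fun A (f x)) ->
  (forall x t, a <= x <= b -> A t -> 0 < f x t) ->
  {ae mu, forall t, A t -> forall x, a <= x <= b -> derivable (f ^~ t) x 1} ->
  (forall x, a <= x <= b -> exists2 N, mu.-negligible N &
     forall s t, (A `\` N) s -> (A `\` N) t ->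
       0 <= (u s * v t - u t * v s) * (dlog1 f x s - dlog1 f x t)) ->
  {ae mu, forall s, A s -> {ae mu, forall t, A t ->
     0 <= (u s * v t - u t * v s) * (f b s * f a t - f b t * f a s)}}.
Proof.
move=> mA sfA ab mu_ mv mf f0 df H.
have [m mE] := restrict_sigma_finite mA sfA.
have aab : a <= a <= b by rewrite lexx.
have bab : a <= b <= b by rewrite lexx ab.
have [N0 [mN0 N00 dfN0]] := df.
pose D0 := A `\` N0.
have mD0 : measurable D0 by exact: measurableD.
have D0A : D0 `<=` A by exact: subDsetl.
have dfD0 t x : D0 t -> a <= x <= b -> derivable (f ^~ t) x 1.
  move=> [At N0t] axb; apply: contrapT => nd; apply/N0t/dfN0 => /= /(_ At) d.
  exact/nd/d.
pose D := D0 `*` D0.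
have mD : measurable D by exact: measurableX.
have mfst (g : measurableTypeR R -> R) : measurable_fun A g ->
    measurable_fun D (fun z => g z.1).
  move=> mg; apply: (measurable_comp mA _ mg) => [_ [z [D1 _] <-]|].
    exact: D0A.
  exact: measurable_funS measurable_fst.
have msnd (g : measurableTypeR R -> R) : measurable_fun A g ->
    measurable_fun D (fun z => g z.2).
  move=> mg; apply: (measurable_comp mA _ mg) => [_ [z [_ D2] <-]|].
    exact: D0A.
  exact: measurable_funS measurable_snd.
pose w (z : measurableTypeR R * measurableTypeR R) :=
  u z.1 * v z.2 - u z.2 * v z.1.
pose F (x : R) z : R := w z * (f x z.1 * (f x z.2)^-1).
have mF x : a <= x <= b -> measurable_fun D (F x).
  move=> axb; apply: measurable_funM.
    apply: measurable_funB; apply: measurable_funM.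
    - exact: mfst.
    - exact: msnd.
    - exact: msnd.
    - exact: mfst.
  apply: measurable_funM; first by apply: mfst; exact: mf.
  apply: measurable_fun_inv_gt0; last by apply: msnd; exact: mf.
  by move=> z [_ /D0A]; exact: f0.
have dF z x : D z -> a <= x <= b -> is_derive x (1 : R) (F ^~ z)
    (w z * (f x z.1 / f x z.2) * (dlog1 f x z.1 - dlog1 f x z.2)).
  move=> [Ds Dt] axb.
  have fs : is_derive x (1 : R) (f ^~ z.1) (partial1of2 f x z.1).
    by rewrite partial1of2E; apply: DeriveDef => //; exact: dfD0.
  have ft : is_derive x (1 : R) (f ^~ z.2) (partial1of2 f x z.2).
    by rewrite partial1of2E; apply: DeriveDef => //; exact: dfD0.
  have fs0 : f x z.1 != 0 by rewrite gt_eqF// f0//; exact: D0A.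
  have ft0 : f x z.2 != 0 by rewrite gt_eqF// f0//; exact: D0A.
  have fti := is_deriveV ft0 ft.
  have fq := is_deriveM fs fti.
  have wfq := is_deriveZ (w z) fq.
  apply: is_derive_eq wfq _.
  rewrite /dlog1 /GRing.scale/=.
  by field; rewrite fs0 ft0.
have F0 x : a <= x <= b ->
    {ae (m \x m)%E, forall z, D z -> 0 <= ('D_1 (F ^~ z) x : R)}.
  move=> axb; have [N [M [mM M0 NM]] HN] := H x axb.
  have mM0 : m M = 0%E.
    by rewrite mE; apply: subset_measure0 M0 => //; exact: measurableI.
  have MM0 : (m \x m)%E.-negligible ((M `*` setT) `|` (setT `*` M)).
    apply: negligibleU; apply/negligibleP; try exact: measurableX.
      by rewrite -(mul0e (m setT)) -mM0; exact: product_measure1E.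
    by rewrite -(mule0 (m setT)) -mM0; exact: product_measure1E.
  apply: negligibleS MM0 => z /= /not_implyP[Dz Fz].
  apply: contrapT => /not_orP[Mz1 Mz2].
  apply: Fz; have dFz := dF z x Dz axb; rewrite derive_val.
  case: (Dz) => [/D0A As /D0A At].
  rewrite mulrAC mulr_ge0//; last by rewrite divr_ge0// ltW// f0.
  by apply: HN; split => // Nz; [apply: Mz1|apply: Mz2]; split => //; exact: NM.
have dF' z : D z -> forall x, a <= x <= b -> derivable (F ^~ z) x 1.
  by move=> Dz x axb; case: (dF z x Dz axb).
have notN0 : {ae mu, forall t, ~ N0 t}.
  by exists N0; split => // t /= /contrapT.
have sfD := sigma_finite_product m m mD.
have := ae_le_of_ae_derive_ge0 mD sfD ab mF dF' F0.
move=> /ae_null_xsection /(ae_restrict mA mE).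
apply: filterS2 (notN0) => s N0s Hs As.
have /(ae_restrict mA mE) := Hs As.
apply: filterS2 notN0 => t N0t Ht At.
have fas : 0 < f a s by exact: f0.
have fat : 0 < f a t by exact: f0.
have fbt : 0 < f b t by exact: f0.
have := Ht At (conj (conj As N0s) (conj At N0t)); rewrite /F/= -subr_ge0.
have -> : w (s, t) * (f b s / f b t) - w (s, t) * (f a s / f a t) =
    w (s, t) * (f b s * f a t - f b t * f a s) / (f b t * f a t).
  by field; rewrite !gt_eqF.
by rewrite pmulr_lge0// invr_gt0 mulr_gt0.
Qed.

(** Recovers the measurability of f(a, .) from that of the two integrands. *)
Lemma measurable_fun_of_weighted d (T : measurableType d) (R : realType)
    (A : set T) (u v g : T -> R) :
  (forall t, A t -> 0 < u t + v t) ->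
  measurable_fun A u -> measurable_fun A v ->
  measurable_fun A (fun t => u t * g t) ->
  measurable_fun A (fun t => v t * g t) ->
  measurable_fun A g.
Proof.
move=> uv0 mu_ mv mug mvg.
apply: (eq_measurable_fun (fun t => (u t * g t + v t * g t) * (u t + v t)^-1)).
  move=> t; rewrite inE => /uv0 /gt_eqF uv.
  by rewrite -mulrDl mulrAC mulfV ?mul1r// uv.
apply: measurable_funM; first exact: measurable_funD.
by apply: measurable_fun_inv_gt0 => //; exact: measurable_funD.
Qed.

(** * Monotonicity and the sign of the cross product *)

(** The convention that the quotient is +oo when v vanishes agrees with the
    cross-multiplied inequality, in which a vanishing v (t) leaves
    0 <= u t * v s. *)
Lemma equotient_le_cross (R : realType) (u v : R -> R) (s t : R) :
  0 <= u s -> 0 <= u t -> 0 <= v s -> 0 <= v t ->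
  (equotient u v s <= equotient u v t)%E -> u s * v t <= u t * v s.
Proof.
move=> us ut vs vt; rewrite /equotient.
have [->|vt0] := eqVneq (v t) 0; first by rewrite mulr0 mulr_ge0.
have [->|vs0] := eqVneq (v s) 0; first by [].
rewrite lee_fin ler_pdivrMr ?lt_neqAle 1?eq_sym ?vs0// mulrAC.
by rewrite ler_pdivlMr// lt_neqAle eq_sym vt0.
Qed.

(** Exchanging s and t changes the sign of both factors. *)
Lemma cross_ge0_of_le (R : realType) (B : set R) (u v h : R -> R) :
  (forall s t, B s -> B t -> s <= t ->
     0 <= (u s * v t - u t * v s) * (h s - h t)) ->
  forall s t, B s -> B t -> 0 <= (u s * v t - u t * v s) * (h s - h t).
Proof.
move=> H s t Bs Bt; have [st|/ltW ts] := leP s t; first exact: H.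
by have := H t s Bt Bs ts; congr (0 <= _); ring.
Qed.

(** For s <= t, the two factors are both nonpositive in the nondecreasing case
    and both nonnegative in the nonincreasing case. *)
Lemma ae_comonotone_cross_ge0 (R : realType)
    (mu : {measure set (measurableTypeR R) -> \bar R}) (A : set R)
    (u v h : R -> R) :
  (forall t, A t -> 0 <= u t) -> (forall t, A t -> 0 <= v t) ->
  (ae_nondecreasing_on mu A h /\ ae_nondecreasing_on mu A (equotient u v)) \/
  (ae_nonincreasing_on mu A h /\ ae_nonincreasing_on mu A (equotient u v)) ->
  exists2 N, mu.-negligible N & forall s t, (A `\` N) s -> (A `\` N) t ->
    0 <= (u s * v t - u t * v s) * (h s - h t).
Proof.
move=> u0 v0 [] [[N1 n1 h1] [N2 n2 h2]].
all: exists (N1 `|` N2); [exact: negligibleU|apply: cross_ge0_of_le].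
all: move=> s t [As /not_orP[s1 s2]] [At /not_orP[t1 t2]] st.
all: have := h1 s t (mem_set (conj As s1)) (mem_set (conj At t1)) st.
all: have := h2 s t (mem_set (conj As s2)) (mem_set (conj At t2)) st.
all: move=> /equotient_le_cross cr hh.
all: have := cr (u0 _ _) (u0 _ _) (v0 _ _) (v0 _ _).
  move=> /(_ As At As At) {}cr; apply: mulr_le0; lra.
move=> /(_ At As At As) {}cr; apply: mulr_ge0; lra.
Qed.

Lemma ae_nonincreasing_onN (R : realType)
    (mu : {measure set (measurableTypeR R) -> \bar R}) (A : set R)
    (h : R -> R) :
  ae_nondecreasing_on mu A h -> ae_nonincreasing_on mu A (fun t => - h t).
Proof. by case=> N n hN; exists N => // s t Ns Nt st; rewrite lerN2 hN. Qed.

Lemma ae_nondecreasing_onN (R : realType)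
    (mu : {measure set (measurableTypeR R) -> \bar R}) (A : set R)
    (h : R -> R) :
  ae_nonincreasing_on mu A h -> ae_nondecreasing_on mu A (fun t => - h t).
Proof. by case=> N n hN; exists N => // s t Ns Nt st; rewrite lerN2 hN. Qed.

(** Replacing h by - h reduces this to the comonotone case; the sign is
    absorbed by exchanging u and v. *)
Lemma ae_countermonotone_cross_ge0 (R : realType)
    (mu : {measure set (measurableTypeR R) -> \bar R}) (A : set R)
    (u v h : R -> R) :
  (forall t, A t -> 0 <= u t) -> (forall t, A t -> 0 <= v t) ->
  (ae_nondecreasing_on mu A h /\ ae_nonincreasing_on mu A (equotient u v)) \/
  (ae_nonincreasing_on mu A h /\ ae_nondecreasing_on mu A (equotient u v)) ->
  exists2 N, mu.-negligible N & forall s t, (A `\` N) s -> (A `\` N) t ->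
    0 <= (v s * u t - v t * u s) * (h s - h t).
Proof.
move=> u0 v0 huv.
have [|N nN HN] := @ae_comonotone_cross_ge0 _ mu A u v (fun t => - h t) u0 v0.
  case: huv => -[hh huv]; [right|left]; split => //.
    exact: ae_nonincreasing_onN.
  exact: ae_nondecreasing_onN.
by exists N => // s t Ns Nt; have := HN s t Ns Nt; congr (0 <= _); ring.
Qed.

Theorem lemma2p2 (R : realType) (I : set R) (A : set (measurableTypeR R))
  (mu : {measure set (measurableTypeR R) -> \bar R})
  (u v : measurableTypeR R -> R) (f : R -> measurableTypeR R -> R)
  (I_itv : is_interval I) (I_open : open I)
  (A_nonempty : A !=set0) (A_borel : measurable A)
  (mu_sigma_finite : sigma_finite A mu)
  (u_meas : measurable_fun A u) (v_meas : measurable_fun A v)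
  (u_ge0 : forall t, A t -> 0 <= u t) (v_ge0 : forall t, A t -> 0 <= v t)
  (uv_neq0 : ~ exists t, [/\ A t, u t = 0 & v t = 0])
  (f_gt0 : forall a t, I a -> A t -> 0 < f a t)
  (f_diff : {ae mu, forall t, A t -> forall a, I a -> derivable (f ^~ t) a 1})
  (uf_int : forall a, I a -> mu.-integrable A (fun t => (u t * f a t)%:E))
  (vf_int : forall a, I a -> mu.-integrable A (fun t => (v t * f a t)%:E))
  (f_dom : forall K : set R, compact K -> K `<=` I ->
     exists g : measurableTypeR R -> R,
       [/\ forall t, A t -> 0 <= g t,
           mu.-integrable A (fun t => (u t * g t)%:E),
           mu.-integrable A (fun t => (v t * g t)%:E)
         & forall a, K a ->
             {ae mu, forall t, A t -> `|partial1of2 f a t| <= g t}])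
  (fv_neq0 : forall a, I a -> \int[mu]_(t in A) (f a t * v t) != 0) :
  ((forall a, I a ->
       (ae_nondecreasing_on mu A (dlog1 f a) /\
        ae_nondecreasing_on mu A (equotient u v)) \/
       (ae_nonincreasing_on mu A (dlog1 f a) /\
        ae_nonincreasing_on mu A (equotient u v))) ->
     nondecreasing_on I (Fquot mu A f u v)) /\
  ((forall a, I a ->
       ae_nondecreasing_on mu A (dlog1 f a) /\
       ae_nonincreasing_on mu A (equotient u v)) \/
   (forall a, I a ->
       ae_nonincreasing_on mu A (dlog1 f a) /\
       ae_nondecreasing_on mu A (equotient u v)) ->
     nonincreasing_on I (Fquot mu A f u v)).
Proof.
have f_meas x : I x -> measurable_fun A (f x).
  move=> Ix; apply: (@measurable_fun_of_weighted _ _ _ _ u v) => //.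
  - move=> t At; rewrite lt_neqAle addr_ge0 ?u_ge0 ?v_ge0// andbT eq_sym.
    rewrite paddr_eq0 ?u_ge0 ?v_ge0//; apply/negP => /andP[/eqP ut /eqP vt].
    by apply: uv_neq0; exists t.
  - by apply/measurable_EFinP; exact: measurable_int (uf_int _ Ix).
  - by apply/measurable_EFinP; exact: measurable_int (vf_int _ Ix).
(* stated for a pair p, q so that it serves both for u, v and for v, u *)
have cross (p q : measurableTypeR R -> R) :
    measurable_fun A p -> measurable_fun A q ->
    (forall x, I x -> mu.-integrable A (fun t => (p t * f x t)%:E)) ->
    (forall x, I x -> mu.-integrable A (fun t => (q t * f x t)%:E)) ->
    (forall x, I x -> exists2 N, mu.-negligible N &
      forall s t, (A `\` N) s -> (A `\` N) t ->
        0 <= (p s * q t - p t * q s) * (dlog1 f x s - dlog1 f x t)) ->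
    forall a b, I a -> I b -> a <= b ->
    (\int[mu]_(t in A) (f a t * p t)) * (\int[mu]_(t in A) (f b t * q t)) <=
    (\int[mu]_(t in A) (f b t * p t)) * (\int[mu]_(t in A) (f a t * q t)).
  move=> mp mq ip iq H a b Ia Ib ab.
  have abI x : a <= x <= b -> I x by exact: I_itv.
  have comm (g h : measurableTypeR R -> R) :
      mu.-integrable A (fun t => (g t * h t)%:E) ->
      mu.-integrable A (fun t => (h t * g t)%:E).
    by congr (_.-integrable _ _); apply/funext => t; rewrite mulrC.
  apply: Rintegral_cross_le => //.
  - by apply: comm; exact: ip.
  - by apply: comm; exact: iq.
  - by apply: comm; exact: ip.
  - by apply: comm; exact: iq.
  apply: ratio_cross_le_ae => //.
  - by move=> x /abI; exact: f_meas.
  - by move=> x t /abI Ix; exact: f_gt0.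
  - by apply: filterS f_diff => t d At x /abI; exact: d.
  - by move=> x /abI; exact: H.
have fv_gt0 x : I x -> 0 < \int[mu]_(t in A) (f x t * v t).
  move=> Ix; rewrite lt_neqAle eq_sym fv_neq0//= Rintegral_ge0// => t At.
  by rewrite mulr_ge0 ?v_ge0// ltW// f_gt0.
split=> H x y /set_mem Ix /set_mem Iy xy.
- rewrite /Fquot ler_pdivrMr ?fv_gt0// mulrAC ler_pdivlMr ?fv_gt0//.
  apply: cross => // z Iz.
  by apply: ae_comonotone_cross_ge0 => //; exact: H.
- rewrite /Fquot ler_pdivrMr ?fv_gt0// mulrAC ler_pdivlMr ?fv_gt0//.
  (* the same inequality with the roles of u and v exchanged *)
  rewrite mulrC [leRHS]mulrC; apply: cross => // z Iz.
  apply: ae_countermonotone_cross_ge0 => //.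
  by case: H => /(_ z Iz); [left|right].
Qed.
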